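(* Let $\mathcal{I}$ be an ideal on $\omega$. Then the following statements are equivalent: (a) $\mathcal{I}$ is Ramsey. (b) $\mathcal{I}$ is $\textrm{h-FinBW}_n$ for all $n\geq 2$.
   Context: An ideal on $\omega$ is a family $\mathcal{I}\subseteq\wp(\omega)$ containing all finite sets, with $\omega\notin\mathcal{I}$, closed under subsets and finite unions. $\mathcal{I}^+$ is the family of infinite subsets of $\omega$ not in $\mathcal{I}$. $[A]^n$ is the family of subsets of $A$ of size $n$. $\mathcal{I}$ is Ramsey if for every $A\in\mathcal{I}^+$ and every $\pi:[A]^2\to 2$ there is $H\in\mathcal{I}^+$, $H\subseteq A$, such that $\pi$ is constant on $[H]^2$. For infinite $A\subseteq\omega$ and $m\in\omega$, $A/m=\{j\in A:m<j\}$. For a topological space $\mathcal{X}$, a function $f:[A]^n\to\mathcal{X}$ converges to $p\in\mathcal{X}$ if for every open neighborhood $U$ of $p$ there is $m\in\omega$ such that $f(s)\in U$ for all $s\in[A/m]^n$; it is convergent if it converges to some $p\in\mathcal{X}$. $\mathcal{I}$ is $\textrm{h-FinBW}_n$ if for every $A\in\mathcal{I}^+$ and every bounded $f:[A]^n\to\mathbb{R}$ there is $B\in\mathcal{I}^+$, $B\subseteq A$, such that $f\restriction[B]^n$ is convergent (in $\mathbb{R}$). *)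

(* Defs.v *)
From HB Require Import structures.
From mathcomp Require Import all_boot all_order all_algebra finmap.
From mathcomp Require Import all_classical all_reals topology normedtype.

Set Implicit Arguments.
Unset Strict Implicit.
Unset Printing Implicit Defensive.

Import Order.TTheory GRing.Theory Num.Theory.
Import numFieldNormedType.Exports.

Local Open Scope classical_set_scope.
Local Open Scope ring_scope.

Record is_ideal (I : set (set nat)) : Prop := IsIdeal {
  ideal_finite : forall A : set nat, finite_set A -> I A;
  ideal_proper : ~ I setT;
  ideal_subset : forall A B : set nat, A `<=` B -> I B -> I A;
  ideal_setU : forall A B : set nat, I A -> I B -> I (A `|` B)
}.

Definition ideal_plus (I : set (set nat)) : set (set nat) :=
  [set A | infinite_set A /\ ~ I A].

(* [A]^n.  A function on [A]^n is encoded below by a total function on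
   {fset nat}, of which only the values on [nsubsets A n] are ever used;
   restricting it to [B]^n for B `<=` A thus needs no operation. *)
Definition nsubsets (A : set nat) (n : nat) : set {fset nat} :=
  [set s : {fset nat} | [set` s] `<=` A /\ #|` s| = n].

(* A/m *)
Definition above (A : set nat) (m : nat) : set nat :=
  [set j | A j /\ (m < j)%N].

Definition is_Ramsey (I : set (set nat)) : Prop :=
  forall A : set nat, ideal_plus I A ->
  forall pi : {fset nat} -> bool,
  exists H : set nat, [/\ ideal_plus I H, H `<=` A &
    exists c : bool, forall s, nsubsets H 2 s -> pi s = c].

Definition converges_to (X : topologicalType) (A : set nat) (n : nat)
    (f : {fset nat} -> X) (p : X) : Prop :=
  forall U : set X, open U -> U p ->
  exists m : nat, forall s, nsubsets (above A m) n s -> U (f s).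

Definition convergent (X : topologicalType) (A : set nat) (n : nat)
    (f : {fset nat} -> X) : Prop :=
  exists p : X, converges_to A n f p.

Definition hFinBW (R : realType) (n : nat) (I : set (set nat)) : Prop :=
  forall A : set nat, ideal_plus I A ->
  forall f : {fset nat} -> R, [bounded f s | s in nsubsets A n] ->
  exists B : set nat, [/\ ideal_plus I B, B `<=` A & convergent B n f].

(* Main.v *)
Require Import Defs.
From mathcomp Require Import all_boot all_order all_algebra finmap.
From mathcomp Require Import all_classical all_reals topology normedtype.
From mathcomp Require Import zify lra.

(** Call the members of [ideal_plus I] positive.

    (a) implies (b).  By induction on [n], a bounded function [f] on [[A]^n]
    converges on [[B]^n] for some positive [B `<=` A] ([Ramsey_convergent]); the
    induction starts at [n = 0], where there is nothing to do.  For the step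
    from [n] to [n.+1], the Ramsey property is used twice.

    - Each finite [s] and rational [q] give the 0-1 sequence
      [j |-> (f (s U {j}) < q)].  These sequences are countably many, so
      together they attach to every [j] a point of the Cantor space.  Colour
      pairs according to whether the lexicographic order agrees with the order
      of [nat].  On a homogeneous set the points of the Cantor space are
      monotone, so every coordinate is eventually constant
      ([Ramsey_eventually_constant]).  Hence [f (s U {j})] has a limit [L s]
      as [j] grows, for all [s] at once ([decided_limit]).

    - The induction hypothesis makes [L] converge to some [p].  Colour a pair
      [i < j] according to whether [f (s U {j})] is within [1 / (i + 1)] of
      [L s] for every [s] of size [n] below [i].  For fixed [i] almost all [j]
      are good, so no infinite set is homogeneous for the bad colour.  On a
      set homogeneous for the good colour [f] inherits the limit [p]
      ([Ramsey_limit_step]).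

    (b) implies (a).  A 0-1 colouring of pairs is a bounded real function.
    Where it converges it is constant after deletion of finitely many points,
    and such a deletion does not affect positivity ([hFinBW2_Ramsey]). *)

Set Implicit Arguments.
Unset Strict Implicit.
Unset Printing Implicit Defensive.

Import Order.TTheory GRing.Theory Num.Theory.
Import numFieldNormedType.Exports.

Local Open Scope classical_set_scope.
Local Open Scope ring_scope.

(** * Finite and infinite sets of natural numbers *)

Lemma infinite_nat_above (H : set nat) (m : nat) :
  infinite_set H -> exists2 i, H i & (m < i)%N.
Proof.
move=> Hinf; apply: contrapT => noi; apply: Hinf.
apply: (@sub_finite_set _ _ `I_m.+1); last exact: finite_II.
move=> i Hi /=; rewrite ltnS leqNgt; apply/negP => mi.
by apply: noi; exists i.
Qed.

Lemma fset_nat_max (s : {fset nat}) : s != fset0 ->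
  exists2 j, j \in s & forall i, i \in s -> (i <= j)%N.
Proof.
move=> /fset0Pn [x xs].
have ex : exists i, i \in s by exists x.
have bd i : i \in s -> (i <= \max_(k <- s) k)%N.
  by move=> si; rewrite (big_rem i) //= leq_maxl.
by case: (ex_maxnP ex bd) => j sj jmax; exists j.
Qed.

Lemma nsubsetsS_max (A : set nat) (n : nat) (s : {fset nat}) :
  nsubsets A n.+1 s ->
  exists j t, [/\ s = (j |` t)%fset, A j, nsubsets A n t &
    forall i, i \in t -> (i < j)%N].
Proof.
move=> [sA cs].
have [|j js jmax] := @fset_nat_max s.
  by rewrite -cardfs_gt0 cs.
exists j, (s `\ j)%fset; split.
- by rewrite fsetD1K.
- exact: sA.
- split; first by move=> i /=; rewrite !inE => /andP[_]; apply: sA.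
  by have := cardfsD1 j s; rewrite cs js add1n => -[].
- by move=> i; rewrite !inE => /andP[ij /jmax]; rewrite ltn_neqAle ij.
Qed.

Lemma nsubsets_above (A : set nat) (m n : nat) (s : {fset nat}) :
  nsubsets (above A m) n s ->
  nsubsets A n s /\ forall i, i \in s -> (m < i)%N.
Proof.
move=> [sA cs]; split; last by move=> i /sA [].
by split => // i /sA [].
Qed.

Lemma nsubsetsU1 (A : set nat) (n j : nat) (t : {fset nat}) :
  nsubsets A n t -> A j -> (forall i, i \in t -> (i < j)%N) ->
  nsubsets A n.+1 (j |` t)%fset.
Proof.
move=> [tA ct] Aj tj; split.
  by move=> i /=; rewrite !inE => /orP[/eqP->//|]; apply: tA.
rewrite cardfsU1 ct; have -> // : j \notin t.
by apply/negP => /tj; rewrite ltnn.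
Qed.

Lemma nsubsets_subset (A B : set nat) (n : nat) (s : {fset nat}) :
  B `<=` A -> nsubsets B n s -> nsubsets A n s.
Proof. by move=> BA [sB cs]; split => // i /sB /BA. Qed.

Lemma infinite_near (B : set nat) (P : nat -> Prop) :
  infinite_set B -> (\forall j \near \oo, B j -> P j) -> exists2 j, B j & P j.
Proof.
move=> Binf [N _ NP]; have [j Bj Nj] := infinite_nat_above N Binf.
by exists j => //; apply: (NP j) => //=; apply: ltnW.
Qed.

Lemma near_above (s : {fset nat}) :
  \forall j \near \oo, forall i, i \in s -> (i < j)%N.
Proof.
exists (\max_(k <- s) k).+1 => //= j sj i si; apply: leq_trans sj.
by rewrite ltnS (big_rem i) //= leq_maxl.
Qed.

(** * Consequences of the Ramsey property *)

Lemma Ramsey_rel (I : set (set nat)) (A : set nat) (r : nat -> nat -> Prop) :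
  is_Ramsey I -> ideal_plus I A ->
  exists H, [/\ ideal_plus I H, H `<=` A &
    (forall i j, H i -> H j -> (i < j)%N -> r i j) \/
    (forall i j, H i -> H j -> (i < j)%N -> ~ r i j)].
Proof.
move=> RI IA.
(* Only one pair i < j lies in a two-element set, so the universal
   quantification reads off the relation at that pair. *)
pose pi (s : {fset nat}) :=
  `[< forall i j, i \in s -> j \in s -> (i < j)%N -> r i j >].
have piE i j : (i < j)%N -> pi [fset i; j]%fset = `[< r i j >].
  move=> ij; apply/asboolP/asboolP; first by apply; rewrite ?inE ?eqxx ?orbT.
  move=> rij a b; rewrite !inE => /orP[]/eqP-> /orP[]/eqP->; lia || by [].
have [H [IH HA [c Hc]]] := RI A IA pi.
have pc i j : H i -> H j -> (i < j)%N -> `[< r i j >] = c.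
  move=> Hi Hj ij; rewrite -piE //; apply: Hc; split.
    by move=> k /=; rewrite !inE => /orP[]/eqP->.
  by rewrite cardfs2 (ltn_eqF ij).
exists H; split => //; case: c pc {Hc} => pc; [left|right] => i j Hi Hj ij.
  by apply/asboolP; rewrite pc.
by move=> /asboolP; rewrite pc.
Qed.

(** The pairs are coloured by the lexicographic comparison of [x ^~ i] and
    [x ^~ j].  On a homogeneous set, once the coordinates below [k] have
    stabilised, the coordinate [k] is monotone, hence it stabilises too. *)
Lemma Ramsey_eventually_constant (I : set (set nat)) (A : set nat)
    (x : nat -> nat -> bool) :
  is_Ramsey I -> ideal_plus I A ->
  exists H, [/\ ideal_plus I H, H `<=` A &
    forall k, exists c, \forall j \near \oo, H j -> x k j = c].
Proof.
move=> RI IA.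
pose lexle i j :=
  forall k, (forall l, (l < k)%N -> x l i = x l j) -> x k i -> x k j.
have [H [IH HA lexH]] := Ramsey_rel lexle RI IA.
exists H; split => // k.
have mono_const l N (b : bool) :
    (forall i j, H i -> H j -> (N <= i)%N -> (i < j)%N ->
       x l i = b -> x l j = b) ->
    exists c, \forall j \near \oo, H j -> x l j = c.
  move=> mono; have [[i Hi [Ni xi]]|no] :=
      pselect (exists2 i, H i & (N <= i)%N /\ x l i = b).
    by exists b, i.+1 => //= j ij Hj; apply: (mono i).
  exists (~~ b), N => //= j Nj Hj.
  case: (eqVneq (x l j) b) => [xj|]; first by case: no; exists j.
  by case: (x l j) b {mono no} => -[].
suff /(_ k.+1) [N /(_ k (leqnn _)) [c Nc]] : forall m, exists N,
    forall l, (l < m)%N -> exists c, forall j, H j -> (N <= j)%N -> x l j = c.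
  by exists c, N => //= j Nj Hj; apply: Nc.
elim=> [|m [N HN]]; first by exists 0%N.
have agree l i j : (l < m)%N -> H i -> H j -> (N <= i)%N -> (i < j)%N ->
    x l i = x l j.
  move=> /HN[c Hc] Hi Hj Ni ij.
  by rewrite !Hc // (leq_trans Ni) // ltnW.
have [c [N' _ N'c]] : exists c, \forall j \near \oo, H j -> x m j = c.
  case: lexH => lexH.
    apply: (mono_const m N true) => i j Hi Hj Ni ij.
    by apply: (lexH i j) => // l lm; apply: agree.
  apply: (mono_const m N false) => i j Hi Hj Ni ij xi.
  (* If the coordinate m increased from i to j, then i would precede j
     lexicographically. *)
  apply/negbTE/negP => xj; apply: (lexH i j) => // l eql xl.
  case: (ltngtP l m) => [lm|/eql|->//].
    by rewrite -(agree l i j).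
  by rewrite xi xj.
exists (maxn N N') => l; rewrite ltnS leq_eqVlt => /orP[/eqP->|lm].
  by exists c => j Hj; rewrite geq_max => /andP[_ /N'c]; apply.
have [c' Hc'] := HN l lm; exists c' => j Hj.
by rewrite geq_max => /andP[Nj _]; apply: Hc'.
Qed.

(** * Limits along infinite subsets *)

(** The limit is the supremum [l] of the eventual lower bounds of [g].  For a
    rational [q] on either side of [l], the verdict on [g j < q] is forced by
    the definition of [l], and rationals are dense. *)
Lemma decided_limit (R : realType) (B : set nat) (g : nat -> R) (M : R) :
  infinite_set B -> (\forall j \near \oo, B j -> `|g j| <= M) ->
  (forall q : rat, exists c, \forall j \near \oo, B j -> (g j < ratr q) = c) ->
  exists l, forall e, 0 < e -> \forall j \near \oo, B j -> `|g j - l| < e.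
Proof.
move=> Binf gM decided.
pose S := [set x : R | \forall j \near \oo, B j -> x <= g j].
have S_M : S (- M).
  by apply: filterS gM => j /[apply]; rewrite ler_norml => /andP[].
have S_lt x y : S x -> (\forall j \near \oo, B j -> g j <= y) -> x <= y.
  move=> Sx gy.
  have [|j _ [xg gy']] := @infinite_near B (fun j => x <= g j /\ g j <= y) Binf.
    by apply: filterS2 Sx gy => j xg gy' Bj; split; auto.
  exact: le_trans xg gy'.
have supS : has_sup S.
  split; first by exists (- M).
  exists M => x Sx; apply: S_lt Sx _.
  by apply: filterS gM => j /[apply]; rewrite ler_norml => /andP[].
exists (sup S) => e e0.
have low : \forall j \near \oo, B j -> sup S - e < g j.
  have [q /andP[eq qS]] : exists q : rat, sup S - e < ratr q < sup S.
    have [|q] := @rat_in_itvoo R (sup S - e) (sup S); first lra.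
    by rewrite in_itv /=; exists q.
  have [[] qc] := decided q.
    have [|x Sx] := @sup_adherent _ S (sup S - ratr q) _ supS.
      by rewrite subr_gt0.
    rewrite opprB addrC subrK => qx.
    suff : x <= ratr q by lra.
    by apply: S_lt Sx _; apply: filterS qc => j /[apply] /ltW.
  apply: filterS qc => j /[apply] /negbT; rewrite -leNgt.
  exact: lt_le_trans.
have high : \forall j \near \oo, B j -> g j < sup S + e.
  have [q /andP[Sq qe]] : exists q : rat, sup S < ratr q < sup S + e.
    have [|q] := @rat_in_itvoo R (sup S) (sup S + e); first lra.
    by rewrite in_itv /=; exists q.
  have [[] qc] := decided q.
    by apply: filterS qc => j /[apply] gq; apply: lt_trans gq qe.
  suff : ratr q <= sup S by lra.
  apply: ub_le_sup; first by case: supS.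
  by apply: filterS qc => j /[apply] /negbT; rewrite -leNgt.
apply: filterS2 low high => j lo hi Bj.
by rewrite ltr_norml; have := lo Bj; have := hi Bj; lra.
Qed.

(** Countability of [T] makes the comparisons of all the [g t] with all the
    rationals fit in one sequence of 0-1 sequences. *)
Lemma Ramsey_sequence_limits (R : realType) (I : set (set nat)) (A : set nat)
    (T : countType) (g : T -> nat -> R) :
  is_Ramsey I -> ideal_plus I A ->
  exists B, [/\ ideal_plus I B, B `<=` A &
    forall t M, (\forall j \near \oo, B j -> `|g t j| <= M) ->
    exists l, forall e, 0 < e -> \forall j \near \oo, B j -> `|g t j - l| < e].
Proof.
move=> RI IA.
pose x k j :=
  if @choice.unpickle (T * rat)%type k is Some (t, q) then g t j < ratr q
  else false.
have [B [IB BA xB]] := Ramsey_eventually_constant x RI IA.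
exists B; split => // t M gM.
apply: decided_limit gM _; first by case: IB.
by move=> q; have := xB (choice.pickle (t, q)); rewrite /x choice.pickleK.
Qed.

(** * Functions on finite sets of a given size *)

Section InductionStep.
Variables (R : realType) (B : set nat) (n : nat).
Variables (f L : {fset nat} -> R).
Hypothesis fL : forall t, nsubsets B n t -> forall e : R, 0 < e ->
  \forall j \near \oo, B j -> `|f (j |` t)%fset - L t| < e.

Let good (i j : nat) := forall t, nsubsets B n t ->
  (forall k, k \in t -> (k <= i)%N) -> `|f (j |` t)%fset - L t| < i.+1%:R^-1.

(** Only finitely many [t] lie below [i], so the convergence of
    [f (j |` t)] to [L t] is uniform over them. *)
Lemma near_good i : \forall j \near \oo, B j -> good i j.
Proof.
pose Pi := fpowerset [fset k in iota 0 i.+1]%fset.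
have goodPi (s : seq {fset nat}) : \forall j \near \oo, B j ->
    forall t, t \in s -> nsubsets B n t ->
    `|f (j |` t)%fset - L t| < i.+1%:R^-1.
  elim: s => [|t s IHs]; first by exists 0%N.
  have [Bt|nBt] := pselect (nsubsets B n t).
    have /(_ (i.+1%:R^-1)) := fL Bt; rewrite invr_gt0 ltr0n => /(_ isT) ft.
    apply: filterS2 IHs ft => j sj tj Bj t'.
    rewrite inE => /orP[/eqP->|t's] Bt'; [exact: tj|exact: sj].
  apply: filterS IHs => j sj Bj t'.
  by rewrite inE => /orP[/eqP->//|t's]; apply: sj.
apply: filterS (goodPi Pi) => j Pij Bj t Bt ti; apply: Pij => //.
rewrite fpowersetE; apply/fsubsetP => k kt.
rewrite in_fset -[_ \in _]/(k \in iota 0 i.+1).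
by rewrite mem_iota add0n ltnS ti.
Qed.

(** Write [s] as [j |` t] with [j] its maximum, and let [i < j] be an element of
    [H] bounding [t].  Then [f s] is within [1 / (i + 1)] of [L t], which is
    close to [p]. *)
Lemma converges_to_good (H : set nat) (p : R) :
  infinite_set H -> H `<=` B ->
  (forall i j, H i -> H j -> (i < j)%N -> good i j) ->
  converges_to B n L p -> converges_to H n.+1 f p.
Proof.
move=> Hinf HB goodH Lp U Uo Up.
have /nbhs_ballP [e /= e0 eU] : nbhs p U by exact: open_nbhs_nbhs.
have [|m Hm] := Lp (ball p (e / 2)) (ball_open _ _).
  by apply: ballxx; rewrite divr_gt0.
have [N Ne] : exists N : nat, N.+1%:R^-1 < e / 2.
  have e20 : 0 < e / 2 by rewrite divr_gt0.
  exists (Num.truncn (e / 2)^-1).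
  rewrite -[ltRHS]invrK ltf_pV2 ?posrE ?invr_gt0 ?ltr0n //.
  by rewrite truncnS_gt.
(* The bound m' is an element of H so that it can serve as i when t is empty. *)
have [m' Hm' mNm'] := infinite_nat_above (maxn m N) Hinf.
move: mNm'; rewrite gtn_max => /andP[mm' Nm'].
exists m' => s /nsubsets_above [sH m's].
have [j [t [st Hj tH tj]]] := nsubsetsS_max sH.
have m't k : k \in t -> (m' < k)%N.
  by move=> kt; apply: m's; rewrite st !inE kt orbT.
have m'j : (m' < j)%N by apply: m's; rewrite st !inE eqxx.
have [i [Hi m'i ij ti]] : exists i, [/\ H i, (m' <= i)%N, (i < j)%N &
    forall k, k \in t -> (k <= i)%N].
  have [|i] := @fset_nat_max (m' |` t)%fset.
    by apply/fset0Pn; exists m'; rewrite !inE eqxx.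
  rewrite !inE => im imax; exists i.
  have [m'i ti] : (m' <= i)%N /\ forall k, k \in t -> (k <= i)%N.
    by split=> [|k kt]; apply: imax; rewrite !inE ?eqxx ?kt ?orbT.
  case/orP: im => [/eqP im|it]; first by rewrite im in m'i ti *.
  by split=> //; [case: tH => + _; apply|apply: tj].
have tB := nsubsets_subset HB tH.
have fLt := goodH i j Hi Hj ij t tB ti.
have Ltp : ball p (e / 2) (L t).
  apply: Hm; case: tB => tB ct; split => // k kt; split; first exact: tB.
  by apply: ltn_trans mm' _; apply: m't.
apply: eU; rewrite st; move: Ltp; rewrite -!ball_normE /= => Ltp.
have iN : i.+1%:R^-1 <= N.+1%:R^-1 :> R.
  rewrite lef_pV2 ?posrE ?ltr0n // ler_nat ltnS.
  by apply: leq_trans m'i; apply: ltnW.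
rewrite (splitr e) -(subrKA (L t)).
apply: le_lt_trans (ler_normD _ _) _; apply: ltrD => //.
by rewrite distrC; exact: lt_trans (lt_le_trans fLt iN) Ne.
Qed.

Lemma Ramsey_limit_step (I : set (set nat)) (p : R) :
  is_Ramsey I -> ideal_plus I B -> converges_to B n L p ->
  exists H, [/\ ideal_plus I H, H `<=` B & converges_to H n.+1 f p].
Proof.
move=> RI IB Lp; have [H [IH HB [goodH|badH]]] := Ramsey_rel good RI IB.
  by exists H; split=> //; apply: converges_to_good Lp => //; case: IH.
case: IH => Hinf _; have [i Hi _] := infinite_nat_above 0 Hinf.
have [|j Hj [gij ij]] := @infinite_near H (fun j => good i j /\ (i < j)%N) Hinf.
  apply: filterS2 (near_good i) (nbhs_infty_gt i) => j gj ij Hj.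
  by split=> //; apply: gj; apply: HB.
by case: (badH i j Hi Hj ij).
Qed.

End InductionStep.

Lemma Ramsey_convergent (R : realType) (I : set (set nat)) (n : nat) :
  is_Ramsey I -> forall (A : set nat) (f : {fset nat} -> R) (M : R),
  ideal_plus I A -> (forall s, nsubsets A n s -> `|f s| <= M) ->
  exists B, [/\ ideal_plus I B, B `<=` A & convergent B n f].
Proof.
move=> RI; elim: n => [|n IHn] A f M IA fM.
  exists A; split => //; exists (f fset0) => U _ Uf; exists 0%N => s [_].
  by move=> /eqP; rewrite cardfs_eq0 => /eqP->.
have [B0 [IB0 B0A limB0]] :=
  Ramsey_sequence_limits (fun t j => f (j |` t)%fset) RI IA.
pose lim_at t l := forall e, 0 < e ->
  \forall j \near \oo, B0 j -> `|f (j |` t)%fset - l| < e.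
pose L t := get [set l | lim_at t l].
have nearM t : nsubsets B0 n t ->
    \forall j \near \oo, B0 j -> `|f (j |` t)%fset| <= M.
  move=> tB0; apply: filterS (near_above t) => j tj Bj.
  by apply: fM; apply: (nsubsets_subset B0A); apply: nsubsetsU1.
have limL t : nsubsets B0 n t -> lim_at t (L t).
  move=> /nearM /limB0 [l tl].
  by apply: (@getPex _ [set l | lim_at t l]); exists l.
(* L t is at distance less than 1 from some value of f, whence M + 1. *)
have LM t : nsubsets B0 n t -> `|L t| <= M + 1.
  move=> tB0; have Binf : infinite_set B0 by case: IB0.
  have [|j _ [fj Lj]] := @infinite_near B0 (fun j =>
      `|f (j |` t)%fset| <= M /\ `|f (j |` t)%fset - L t| < 1) Binf.
    by apply: filterS2 (nearM t tB0) (limL t tB0 1 ltr01) => j; auto.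
  have := ler_normB (f (j |` t)%fset) (f (j |` t)%fset - L t).
  by rewrite subKr; lra.
have [B1 [IB1 B10 [p Lp]]] := IHn B0 L (M + 1) IB0 LM.
have [|H [IH HB1 fp]] := @Ramsey_limit_step R B1 n f L _ I p RI IB1 Lp.
  move=> t tB1 e e0; apply: filterS (limL t (nsubsets_subset B10 tB1) e e0).
  by move=> j fj /B10.
exists H; split => //; last by exists p.
by move=> i /HB1 /B10 /B0A.
Qed.

(** * Colourings as real functions *)

Lemma ideal_plus_above (I : set (set nat)) (A : set nat) (m : nat) :
  is_ideal I -> ideal_plus I A -> ideal_plus I (above A m).
Proof.
move=> hI [Ainf IA].
have Afin : finite_set (A `\` above A m).
  apply: (@sub_finite_set _ _ `I_m.+1); last exact: finite_II.
  move=> i [Ai nAi] /=; rewrite ltnS leqNgt; apply/negP => mi.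
  exact: nAi.
have AE : A `<=` (A `\` above A m) `|` above A m.
  by move=> i Ai; have [?|?] := pselect (above A m i); [right|left].
split=> [fin|Ia].
  by apply: Ainf; apply: sub_finite_set AE _; rewrite finite_setU.
apply: IA; apply: (ideal_subset hI AE); apply: (ideal_setU hI) => //.
exact: (ideal_finite hI).
Qed.

Lemma hFinBW2_Ramsey (R : realType) (I : set (set nat)) :
  is_ideal I -> hFinBW R 2 I -> is_Ramsey I.
Proof.
move=> hI bw A IA pi; pose f s : R := (pi s)%:R.
have [|B [IB BA [p fp]]] := bw A IA f.
  exists 1; split => // M M1 s _ /=.
  apply: le_trans (ltW M1); rewrite /f.
  by case: (pi s); rewrite ?normr1 ?normr0.
have [|m Hm] := fp (ball p 2^-1) (ball_open _ _).
  by apply: ballxx; rewrite invr_gt0.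
exists (above B m); split.
- exact: ideal_plus_above.
- by move=> i [/BA].
(* Both values of pi cannot lie within 1/2 of p. *)
exists (p > 2^-1) => s /Hm; rewrite -ball_normE /= /f.
by case: (pi s) => /=; rewrite ltr_norml => /andP[]; case: ltP => //; lra.
Qed.

Theorem proposition3p26 (R : realType) (I : set (set nat)) (hI : is_ideal I) :
  is_Ramsey I <-> (forall n : nat, (2 <= n)%N -> hFinBW R n I).
Proof.
split=> [RI n _ A IA f [M [_ fM]]|bw].
  apply: (@Ramsey_convergent R I n RI A f (M + 1)) => // s sA.
  by apply: fM => //; rewrite ltrDl.
exact: (@hFinBW2_Ramsey R I hI (bw 2 isT)).
Qed.
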